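(* Let $\Gamma$ be any Coxeter graph. There exist a Coxeter graph $\tilde\Gamma$ of small type with no triangle and an injective (monoid) homomorphism $\phi:G_\Gamma^+\to G_{\tilde\Gamma}^+$ from the Artin monoid $G_\Gamma^+$ to the Artin monoid $G_{\tilde\Gamma}^+$ associated with $\tilde\Gamma$.
   Context: Let $S$ be a finite set. A Coxeter matrix over $S$ is a matrix $(m_{s,t})_{s,t\in S}$ with $m_{s,s}=1$, and $m_{s,t}=m_{t,s}\in\{2,3,4,\dots,+\infty\}$ for $s\ne t$. It is encoded by its Coxeter graph $\Gamma$: the (finite) vertex set is $S$, two vertices $s,t$ are joined by an edge iff $m_{s,t}\ge 3$, and the edge is labelled by $m_{s,t}$ if $m_{s,t}\ge 4$. $\Gamma$ is of small type if $m_{s,t}\in\{2,3\}$ for all $s\ne t$; it has no triangle if there is no triple $\{s,t,r\}$ in $S$ with $m_{s,t},m_{s,r},m_{t,r}\ge3$. $\mathrm{prod}(a,b;m)$ denotes the alternating word $aba\cdots$ of length $m$ starting with $a$. The Artin monoid $G_\Gamma^+$ is the monoid (with unit) presented by generators $\sigma_s$ ($s\in S$) and relations $\mathrm{prod}(\sigma_s,\sigma_t;m_{s,t})=\mathrm{prod}(\sigma_t,\sigma_s;m_{s,t})$ for $s\ne t$, $m_{s,t}<+\infty$. Homomorphisms of monoids preserve products and units. *)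

(* Defs.v *)
From HB Require Import structures.
From mathcomp Require Import all_boot.
From mathcomp Require Import boolp.

Set Implicit Arguments.
Unset Strict Implicit.
Unset Printing Implicit Defensive.

(* Entries of a Coxeter matrix live in {1, 2, 3, ...} U {+oo}; [None] encodes
   +oo, so that it is above every natural number. *)
Definition cox_label := option nat.

Definition label_ge (k : nat) (m : cox_label) : bool :=
  if m is Some n then k <= n else true.

Record coxeterMatrix (S : finType) := CoxeterMatrix {
  cox_entry :> S -> S -> cox_label;
  cox_diag : forall s, cox_entry s s = Some 1;
  cox_sym : forall s t, cox_entry s t = cox_entry t s;
  cox_offdiag : forall s t, s != t -> label_ge 2 (cox_entry s t)
}.

(* A Coxeter graph carries exactly the data of its Coxeter matrix: s and t are
   joined iff m_{s,t} >= 3, and absent (resp. unlabelled) edges stand for 2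
   (resp. 3). *)
Record coxeterGraph := CoxeterGraph {
  vertex :> finType;
  cox_matrix : coxeterMatrix vertex
}.

Definition cox_edge (G : coxeterGraph) (s t : G) : bool :=
  (s != t) && label_ge 3 (cox_matrix G s t).

Definition small_type (G : coxeterGraph) : Prop :=
  forall s t : G, s != t ->
    cox_matrix G s t = Some 2 \/ cox_matrix G s t = Some 3.

(* The three vertices are automatically distinct, edges being irreflexive. *)
Definition no_triangle (G : coxeterGraph) : Prop :=
  ~ exists s t r : G, [/\ cox_edge s t, cox_edge s r & cox_edge t r].

Fixpoint alt_word (T : Type) (a b : T) (m : nat) : seq T :=
  if m is m'.+1 then a :: alt_word b a m' else [::].

(* The congruence on the free monoid [seq G] generated by the Artin
   relations. *)
Inductive artin_cong (G : coxeterGraph) : seq G -> seq G -> Prop :=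
| artin_rel (s t : G) (m : nat) :
    s != t -> cox_matrix G s t = Some m ->
    artin_cong (alt_word s t m) (alt_word t s m)
| artin_refl u : artin_cong u u
| artin_sym u v : artin_cong u v -> artin_cong v u
| artin_trans u v w : artin_cong u v -> artin_cong v w -> artin_cong u w
| artin_cat u u' v v' :
    artin_cong u u' -> artin_cong v v' -> artin_cong (u ++ v) (u' ++ v').

Section ArtinMonoid.

Local Open Scope quotient_scope.

Variable G : coxeterGraph.

Definition artin_congb : rel (seq G) := fun u v => `[< artin_cong u v >].

Lemma artin_congb_equiv : equiv_class_of artin_congb.
Proof.
split=> [u | u v | v u w].
- by apply/asboolP; apply: artin_refl.
- by apply/asboolP/asboolP => /artin_sym.
- by move=> /asboolP uv /asboolP vw; apply/asboolP; apply: artin_trans vw.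
Qed.

Canonical artin_equiv := EquivRelPack artin_congb_equiv.

Definition artinMonoid := {eq_quot artin_equiv}.

HB.instance Definition _ := Choice.on artinMonoid.
HB.instance Definition _ := Quotient.on artinMonoid.

Definition artin_word (u : seq G) : artinMonoid := \pi u.

Definition artin_gen (s : G) : artinMonoid := artin_word [:: s].

Lemma artin_wordP u v : artin_word u = artin_word v <-> artin_cong u v.
Proof.
by split=> [/eqmodP /asboolP | uv]; last by apply/eqmodP; apply/asboolP.
Qed.

Lemma artin_word_repr (x : artinMonoid) : artin_word (repr x) = x.
Proof. exact: reprK. Qed.

Definition artin_mul (x y : artinMonoid) : artinMonoid :=
  artin_word (repr x ++ repr y).

Lemma artin_word_cat u v :
  artin_word (u ++ v) = artin_mul (artin_word u) (artin_word v).
Proof.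
by apply/artin_wordP/artin_cat; apply/artin_wordP; rewrite artin_word_repr.
Qed.

Lemma artin_mulA : associative artin_mul.
Proof.
move=> x y z; rewrite -(artin_word_repr x) -(artin_word_repr y).
by rewrite -(artin_word_repr z) -!artin_word_cat catA.
Qed.

Lemma artin_1mul : left_id (artin_word [::]) artin_mul.
Proof. by move=> x; rewrite -(artin_word_repr x) -artin_word_cat. Qed.

Lemma artin_mul1 : right_id (artin_word [::]) artin_mul.
Proof. by move=> x; rewrite -(artin_word_repr x) -artin_word_cat cats0. Qed.

HB.instance Definition _ :=
  isMonoid.Build artinMonoid artin_mulA artin_1mul artin_mul1.

End ArtinMonoid.

(* Main.v *)
Require Import Defs.
From mathcomp Require Import all_boot.
From mathcomp Require Import order ssralg ssrnum ssrint zify.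

(* Proof, after Crisp and Paris. A map [T] from the generators of an Artin
   monoid to a left cancellative monoid [M] without nontrivial units induces an
   injective morphism as soon as it respects least common multiples: [T s] and
   [T t] have a common right multiple exactly when [m_{s,t}] is finite, and
   their lcm is then the alternating product of length [m_{s,t}].

   The target has as vertices the pairs [(s, i)], where [i] assigns a site to
   each unordered pair of generators, and [T s] is the product of the commuting
   generators [(s, i)]. Vertices [(s, i)] and [(t, j)] are joined if [i] and [j]
   differ only at [{s, t}], by neighbouring sites of the path with
   [m_{s,t} - 1] vertices, or of a triangle if [m_{s,t}] is infinite. Above
   [{s, t}] one thus sees disjoint copies of the bipartite double cover of this
   path or triangle: pairs of paths A_(m-1) coloured by [s] and [t], or
   6-cycles. In a path, the alternating product of [m] layers is the
   fundamental element, whatever the first colour, and it is the lcm of all the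
   vertices. In a 6-cycle there is no common multiple, because the numbers game
   never decreases the sum of the labels of the cycle.

   Left cancellation and lcms of generators in the target are Garside's: in a
   small type graph without triangles, any three vertices span A1^3, A1 x A2 or
   A3. *)

Set Implicit Arguments.
Unset Strict Implicit.
Unset Printing Implicit Defensive.

Local Open Scope group_scope.

(** * Cancellation and lcms of generators in small type *)

Lemma cox_edgeC (G : coxeterGraph) (s t : G) : cox_edge s t = cox_edge t s.
Proof. by rewrite /cox_edge eq_sym cox_sym. Qed.

Lemma size_alt_word (T : Type) (a b : T) m : size (alt_word a b m) = m.
Proof. by elim: m a b => //= m IHm a b; rewrite IHm. Qed.

Lemma size_artin_cong (G : coxeterGraph) (u v : seq G) :
  artin_cong u v -> size u = size v.
Proof.
elim=> {u v} [s t m _ _|//|//|u v w _ -> _ -> //|u u' v v' _ eq_u _ eq_v].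
  by rewrite !size_alt_word.
by rewrite !size_cat eq_u eq_v.
Qed.

Section ArtinLength.

Variable G : coxeterGraph.
Implicit Types (x y : artinMonoid G) (u v : seq G).

Definition artin_len x := size (repr x).

Lemma artin_len_word u : artin_len (artin_word u) = size u.
Proof. by apply/size_artin_cong/artin_wordP; rewrite artin_word_repr. Qed.

Lemma artin_wordM u v : artin_word (u ++ v) = artin_word u * artin_word v.
Proof. exact: artin_word_cat. Qed.

Lemma artin_word_cons s u : artin_word (s :: u) = artin_gen s * artin_word u.
Proof. by rewrite -cat1s artin_wordM. Qed.

Lemma artin_word0 : artin_word [::] = 1 :> artinMonoid G.
Proof. by []. Qed.

Lemma artin_len1 : artin_len 1 = 0.
Proof. by rewrite -artin_word0 artin_len_word. Qed.

Lemma artin_lenM x y : artin_len (x * y) = artin_len x + artin_len y.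
Proof.
rewrite -(artin_word_repr x) -(artin_word_repr y) -artin_wordM.
by rewrite !artin_len_word size_cat.
Qed.

Lemma artin_len_gen s : artin_len (artin_gen s) = 1%N.
Proof. exact: artin_len_word. Qed.

End ArtinLength.

Section SmallType.

Variable H : coxeterGraph.
Hypothesis smallH : small_type H.
Implicit Types (s t r : H) (x y u v w : artinMonoid H).

Local Notation g := (@artin_gen H).

Lemma small_label s t : s != t ->
  cox_matrix H s t = Some (if cox_edge s t then 3 else 2).
Proof. by move=> st; rewrite /cox_edge st; case: (smallH st) => ->. Qed.

Lemma artin_gen_commute s t : ~~ cox_edge s t -> commute (g s) (g t).
Proof.
move=> nst; have [-> //|st] := eqVneq s t.
have := artin_rel st (small_label st); rewrite (negPf nst) /= => /artin_wordP.
by rewrite !artin_word_cons artin_word0 !mulg1.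
Qed.

Lemma artin_gen_braid s t : cox_edge s t -> g s * g t * g s = g t * g s * g t.
Proof.
move=> est; have st : s != t by case/andP: est.
have := artin_rel st (small_label st); rewrite est /= => /artin_wordP.
by rewrite !artin_word_cons artin_word0 !mulg1 !mulgA.
Qed.

Let com s t x : ~~ cox_edge s t -> g s * (g t * x) = g t * (g s * x).
Proof. by move=> nst; rewrite !mulgA artin_gen_commute. Qed.

Let braid s t x : cox_edge s t ->
  g s * (g t * (g s * x)) = g t * (g s * (g t * x)).
Proof. by move=> est; rewrite !mulgA artin_gen_braid. Qed.

(* [s * gen_compl s t] is the least common right multiple of [s] and [t]. *)
Definition gen_compl s t : artinMonoid H :=
  if s == t then 1 else if cox_edge s t then g t * g s else g t.

Lemma gen_complxx s : gen_compl s s = 1.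
Proof. by rewrite /gen_compl eqxx. Qed.

Hypothesis no_triangleH : no_triangle H.

Let no_tri s t r : cox_edge s t -> cox_edge s r -> cox_edge t r = false.
Proof.
by move=> st sr; apply/negP => tr; apply: no_triangleH; exists s, t, r.
Qed.

(** Garside's induction hypothesis, by length. Its case [s = t] is left cancellation of a
    generator. *)
Let gen_div_upto n := forall s t u v, artin_len u < n -> g s * u = g t * v ->
  exists w, u = gen_compl s t * w /\ v = gen_compl t s * w.

Let lenE := (@artin_lenM H, artin_len_gen).

Local Ltac len_lia :=
  repeat match goal with
  | E : @eq nat _ _ |- _ => move: E
  | E : is_true (leq _ _) |- _ => move: E
  end;
  repeat match goal with |- context [artin_len ?z] => move: (artin_len z) end;
  clear; lia.

Let canc n a p q : gen_div_upto n -> artin_len p < n ->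
  g a * p = g a * q -> p = q.
Proof.
by move=> IHn lp /(IHn _ _ _ _ lp)[w]; rewrite gen_complxx mul1g => -[-> ->].
Qed.

(** The induction hypothesis for distinct generators, together with the length of the quotient so
    that it can be applied again to [w]. *)
Let rem n a b p q : gen_div_upto n -> artin_len p < n -> a != b ->
    g a * p = g b * q ->
  exists w, [/\ p = (if cox_edge a b then g b * (g a * w) else g b * w),
    q = (if cox_edge a b then g a * (g b * w) else g a * w) &
    artin_len p = artin_len w + (cox_edge a b).+1].
Proof.
move=> IHn lp nab /(IHn _ _ _ _ lp)[w]; rewrite /gen_compl [b == a]eq_sym.
rewrite [cox_edge b a]cox_edgeC (negPf nab) => -[pw qw].
by exists w; rewrite pw qw; case: ifP; rewrite -?mulgA !lenE; split=> //;
  len_lia.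
Qed.

(* Middle step of a chain [s * _ = r * z = t * _]; the cases follow the type of
   the graph spanned by [r], [s] and [t]. *)
Let gen_div_trans n r s t z x y : gen_div_upto n -> artin_len z <= n ->
    z = gen_compl r s * x -> z = gen_compl r t * y ->
  exists w, gen_compl s r * x = gen_compl s t * w /\
            gen_compl t r * y = gen_compl t s * w.
Proof.
move=> IHn lz zx zy.
have [ers|nrs] := eqVneq r s.
  by subst s; exists y; rewrite -zy zx gen_complxx mul1g.
have [ert|nrt] := eqVneq r t.
  by subst t; exists x; rewrite -zx zy gen_complxx mul1g.
have [est|nst] := eqVneq s t.
  subst t; exists (gen_compl s r * x); rewrite gen_complxx mul1g; split=> //.
  suff -> : x = y by [].
  have := zy; rewrite zx => e; move: e lz; rewrite zx /gen_compl (negPf nrs).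
  case: ifP => _; rewrite ?lenE -?mulgA => e lx.
    by apply: (canc IHn) (canc IHn _ e); rewrite ?lenE; len_lia.
  by apply: (canc IHn) e; len_lia.
have := congr1 (@artin_len H) zy; move: lz zy; rewrite zx {z zx}.
rewrite /gen_compl (negPf nrs) (negPf nrt) (negPf nst).
rewrite ![_ == r]eq_sym (negPf nrs) (negPf nrt) [t == s]eq_sym (negPf nst).
rewrite [cox_edge t s]cox_edgeC [cox_edge s r]cox_edgeC.
rewrite [cox_edge t r]cox_edgeC.
(* In each case the witness starts with the quotient of the lcm of [r], [s], [t] by that of [s] and
   [t]. The former is a fundamental element: of length 6 in type A3, 4 in type A1 x A2, and 3 in
   type A1^3. *)
case: (boolP (cox_edge r s)) => ers; case: (boolP (cox_edge r t)) => ert;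
  case: (boolP (cox_edge s t)) => est; rewrite ?lenE -?mulgA => lx e ly;
  have [esr etr ets] := And3 ers ert est;
  rewrite cox_edgeC in esr; rewrite cox_edgeC in etr;
  rewrite cox_edgeC in ets;
  have [nsr ntr nts] := And3 nrs nrt nst;
  rewrite eq_sym in nsr; rewrite eq_sym in ntr; rewrite eq_sym in nts.
- by have := no_tri ers ert; rewrite est.
- have [|a [ea eb la]] := rem IHn _ nst e; first by rewrite !lenE; len_lia.
  rewrite (negPf est) !lenE in ea eb la.
  have [|c [ec ea1 lc]] := rem IHn _ nrt ea; first by len_lia.
  have [|d [ed ea2 ld]] := rem IHn _ nrs eb; first by len_lia.
  rewrite ert ers in ec ea1 lc ed ea2 ld.
  have e1 : g t * c = g s * d.
    by apply: (canc IHn (a := r)); [rewrite !lenE; len_lia | rewrite -ea1].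
  have [|f [ef ed1 lf]] := rem IHn _ nts e1; first by len_lia.
  rewrite (negPf ets) in ef ed1 lf.
  exists (g r * (g t * (g s * (g r * f)))); rewrite ec ed ef ed1; split;
    rewrite -?mulgA.
    by rewrite [in LHS](com _ est) [in LHS](braid _ esr) [in LHS](braid _ ert).
  by rewrite [in LHS](com _ ets) [in LHS](braid _ etr) [in LHS](braid _ ers)
    [in LHS](com _ est).
- have [|a [ea ey la]] := rem IHn _ nst e; first by rewrite !lenE; len_lia.
  rewrite est !lenE in ea ey la.
  have [|b [ex eb lb]] := rem IHn _ nrt ea; first by len_lia.
  rewrite (negPf ert) in ex eb lb.
  have [|c [ea1 eb1 lc]] := rem IHn _ nsr eb; first by len_lia.
  rewrite esr in ea1 eb1 lc.
  exists (g r * (g s * (g t * c))); rewrite ey ex eb1 ea1; split;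
    rewrite -?mulgA.
    by rewrite [in LHS](braid _ est) [in LHS](com _ ert) [in LHS](com c etr)
      [in LHS](braid _ ers).
  by rewrite [in LHS](com _ etr) [in LHS](braid _ ers) [in LHS](braid _ est)
    [in LHS](com _ ert).
- have [|a [ea ey la]] := rem IHn _ nst e; first by rewrite !lenE; len_lia.
  rewrite (negPf est) !lenE in ea ey la.
  have [|b [ex eb lb]] := rem IHn _ nrt ea; first by len_lia.
  rewrite (negPf ert) in ex eb lb.
  exists (g r * (g s * b)); rewrite ey ex eb; split; rewrite -?mulgA.
    by rewrite [in LHS](com _ est) [in LHS](com _ ert).
  by rewrite [in LHS](braid _ ers).
- have [|a [ex ea la]] := rem IHn _ nst e; first by len_lia.
  rewrite est in ex ea la; have ly' := congr1 (@artin_len H) ea.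
  rewrite !lenE in ly'.
  have [|b [ey eb lb]] := rem IHn _ nrs ea; first by len_lia.
  rewrite (negPf ers) in ey eb lb.
  have [|c [ea1 eb1 lc]] := rem IHn _ ntr eb; first by len_lia.
  rewrite etr in ea1 eb1 lc.
  exists (g r * (g t * (g s * c))); rewrite ex ey eb1 ea1; split;
    rewrite -?mulgA.
    by rewrite [in LHS](com _ esr) [in LHS](braid _ ert) [in LHS](braid _ ets)
      [in LHS](com _ ers).
  by rewrite [in LHS](braid _ ets) [in LHS](com _ ers) [in LHS](com c esr)
    [in LHS](braid _ ert).
- have [|a [ex ea la]] := rem IHn _ nst e; first by len_lia.
  rewrite (negPf est) in ex ea la; have ly' := congr1 (@artin_len H) ea.
  rewrite !lenE in ly'.
  have [|b [ey eb lb]] := rem IHn _ nrs ea; first by len_lia.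
  rewrite (negPf ers) in ey eb lb.
  exists (g r * (g t * b)); rewrite ex ey eb; split; rewrite -?mulgA.
    by rewrite [in LHS](braid _ ert).
  by rewrite [in LHS](com _ ets) [in LHS](com _ ers).
- have [|a [ex ey la]] := rem IHn _ nst e; first by len_lia.
  rewrite est in ex ey la.
  exists (g r * a); rewrite ex ey; split; rewrite -?mulgA.
    by rewrite [in LHS](com _ ert) [in LHS](com _ ers).
  by rewrite [in LHS](com _ ers) [in LHS](com _ ert).
- have [|a [ex ey la]] := rem IHn _ nst e; first by len_lia.
  rewrite (negPf est) in ex ey la.
  by exists (g r * a); rewrite ex ey (com _ ert) (com _ ers).
Qed.

(** Induction on the derivation. Transitivity is [gen_div_trans], with [r] the first letter of the
    middle word; in a concatenation, the first letters lie in the left factors unless these are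
    empty. *)
Let gen_div_cong n (U V : seq H) : gen_div_upto n ->
    artin_cong U V -> size U <= n.+1 ->
  forall (s t : H) (u v : seq H), U = s :: u -> V = t :: v ->
  exists w, artin_word u = gen_compl s t * w /\
            artin_word v = gen_compl t s * w.
Proof.
move=> IHn; elim=> {U V} [s t m st mst|U|U V UV IH|U V W UV IHU VW IHV|
    U U' V V' UU' IHU VV' IHV] sz a b u v.
- move: mst; rewrite small_label // => -[<-].
  rewrite /gen_compl [b == a]eq_sym [cox_edge b a]cox_edgeC.
  case: ifP => est /= [<- <-] [<- <-]; rewrite (negPf st); exists 1;
  by rewrite !artin_word_cons artin_word0 !mulg1 est.
- by move=> -> -[<- <-]; exists (artin_word u); rewrite gen_complxx mul1g.
- move=> Va Ub; have [|w [vw uw]] := IH _ _ _ _ _ Ub Va; last by exists w.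
  by rewrite (size_artin_cong UV).
- move=> Ua Wb; have szV := size_artin_cong UV.
  case: V => [|c z] in UV IHU VW IHV szV *; first by rewrite Ua in szV.
  have [x [ux zx]] := IHU sz _ _ _ _ Ua erefl.
  have [|y [zy vy]] := IHV _ _ _ _ _ erefl Wb; first by rewrite -szV.
  rewrite ux vy; apply: gen_div_trans IHn _ zx zy.
  by rewrite artin_len_word; move: sz; rewrite szV.
have := size_artin_cong UU'; case: U U' => [|c U] [|d U'] // in UU' IHU sz *.
  by move=> _; apply: IHV.
move=> _ /= [<- <-] [<- <-]; move: sz; rewrite /= size_cat ltnS => sz.
have [|w [Uw Uw']] := IHU _ _ _ _ _ erefl erefl.
  by rewrite ltnS (leq_trans _ sz) ?leq_addr.
exists (w * artin_word V); rewrite !artin_wordM !mulgA -Uw -Uw'; split=> //.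
by congr (_ * _); apply/artin_wordP/artin_sym.
Qed.

Lemma gen_mul_eq s t u v : g s * u = g t * v ->
  exists w, u = gen_compl s t * w /\ v = gen_compl t s * w.
Proof.
suff div n : gen_div_upto n by apply: (div (artin_len u).+1).
elim: n => // n IHn {}s {}t {}u {}v lu.
rewrite -(artin_word_repr u) -(artin_word_repr v) -!artin_word_cons.
by move=> /artin_wordP/(gen_div_cong IHn); apply.
Qed.

Lemma artin_mulIl u : injective (fun x => u * x).
Proof.
move=> x y; rewrite -(artin_word_repr u); elim: (repr u) => [|s l IHl].
  by rewrite artin_word0 !mul1g.
rewrite artin_word_cons -!mulgA => /gen_mul_eq[w].
by rewrite gen_complxx !mul1g => -[xw yw]; apply: IHl; rewrite /= xw yw.
Qed.

End SmallType.

(** * Alternating products of layers of a path *)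

Section AltProd.

Variable M : monoidType.
Implicit Types a b c d : M.

Fixpoint alt_prod a b m : M := if m is m'.+1 then a * alt_prod b a m' else 1.

Lemma alt_prodSr a b m :
  alt_prod a b m.+1 = alt_prod a b m * (if odd m then b else a).
Proof.
elim: m a b => [|m IHm] a b; first by rewrite /= mulg1 mul1g.
rewrite -[LHS]/(a * alt_prod b a m.+1) IHm /= mulgA if_neg.
by case: (odd m).
Qed.

Lemma commute_alt_prod x a b m :
  commute x a -> commute x b -> commute x (alt_prod a b m).
Proof.
elim: m a b => [|m IHm] a b xa xb; first exact: commute1.
by apply: commuteM => //; apply: IHm.
Qed.

Lemma alt_prodM a b c d m : commute c a -> commute c b -> commute d a ->
    commute d b ->
  alt_prod (a * c) (b * d) m = alt_prod a b m * alt_prod c d m.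
Proof.
move=> ca cb da db; elim: m a b c d ca cb da db => [|m IHm] a b c d ca cb da db.
  by rewrite /= mulg1.
rewrite /= IHm // -!mulgA; congr (_ * _); rewrite !mulgA; congr (_ * _).
exact: commute_alt_prod.
Qed.

End AltProd.

Section BraidPath.

Variables (M : monoidType) (N : nat) (x : nat -> M).
Hypothesis xC : forall i j, i.+1 < j -> j < N -> commute (x i) (x j).
Hypothesis xB : forall i, i.+1 < N ->
  x i * x i.+1 * x i = x i.+1 * x i * x i.+1.

Definition layer (p : bool) k n : M := \prod_(k <= i < n | odd i == p) x i.

(** In terms of braids, one strand crossing the sites from [n.-1] down to [k]. *)
Definition desc k n : M := \prod_(i <- rev (index_iota k n)) x i.

Lemma desc_nil n : desc n n = 1.
Proof. by rewrite /desc /index_iota subnn big_nil. Qed.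

Lemma desc_cat k m n : k <= m <= n -> desc k n = desc m n * desc k m.
Proof.
move=> /andP[km mn]; rewrite /desc -big_cat -rev_cat.
by rewrite /index_iota -[in iota m _](subnKC km) -iotaD;
  congr (\prod_(i <- rev (iota _ _)) _); lia.
Qed.

Lemma descSl n : desc n n.+1 = x n.
Proof. by rewrite /desc /index_iota subSnn big_seq1. Qed.

Lemma commute_desc y k n : (forall i, k <= i < n -> commute y (x i)) ->
  commute y (desc k n).
Proof.
move=> yx; rewrite /desc big_seq_cond; apply: commute_prod => i.
by rewrite mem_rev mem_index_iota andbT => /yx.
Qed.

Lemma commute_layer y p k n :
  (forall i, k <= i < n -> odd i = p -> commute y (x i)) ->
  commute y (layer p k n).
Proof.
move=> yx; rewrite /layer big_nat_cond; apply: commute_prod => i.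
by move=> /andP[ikn /eqP]; apply: yx.
Qed.

Lemma layer_cat p k m n : k <= m <= n ->
  layer p k n = layer p k m * layer p m n.
Proof. by move=> /andP[km mn]; rewrite /layer (big_cat_nat km mn). Qed.

Lemma layer_nil p n : layer p n n = 1.
Proof. by rewrite /layer big_geq. Qed.

Lemma layerSl p n : layer p n n.+1 = if odd n == p then x n else 1.
Proof. by rewrite /layer big_ltn_cond // big_geq // mulg1. Qed.

(** A crossing slides through the strand and comes out one site lower: all factors commute with it
    except those at [i] and [i.+1], where one braid relation is applied. *)
Lemma desc_shift l n i : n < N -> l <= i < n ->
  desc l n.+1 * x i.+1 = x i * desc l n.+1.
Proof.
move=> nN /andP[li lin].
rewrite (@desc_cat l i.+2) ?(@desc_cat l i i.+2) ?(@desc_cat i i.+1 i.+2);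
  try lia.
rewrite !descSl -!mulgA.
have -> : desc l i * x i.+1 = x i.+1 * desc l i.
  by apply/esym/commute_desc => j jl; apply/commute_sym/xC; lia.
rewrite (mulgA (x i.+1)) (mulgA _ (x i.+1)) -xB; last by lia.
rewrite -!mulgA mulgA.
have -> // : desc i.+2 n.+1 * x i = x i * desc i.+2 n.+1.
  by apply/esym/commute_desc => j jl; apply/xC; lia.
by rewrite !mulgA.
Qed.

Lemma desc_layer p l n : n < N ->
  desc l n.+1 * layer p l.+1 n.+1 = layer (~~ p) l n * desc l n.+1.
Proof.
move=> nN; rewrite /layer big_add1 /= (eq_bigl (fun i => odd i == ~~ p));
  last first.
  by move=> i /=; case: (odd i) p => -[].
rewrite big_nat_cond [in RHS]big_nat_cond.
elim/big_rec2: _ => [|i y z /andP[lin _] IH]; first by rewrite mulg1 mul1g.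
by rewrite mulgA desc_shift // -mulgA IH mulgA.
Qed.

Lemma layer_desc_step l n : n < N -> l <= n ->
  layer (~~ odd l) 0 l.+1 * desc l.+1 n.+1 * layer (odd l) 0 n.+1 =
  layer (~~ odd l) 0 n * layer (odd l) 0 l * desc l n.+1.
Proof.
move=> nN ln.
rewrite (@layer_cat _ 0 l l.+1) ?leqnSn // layerSl.
rewrite (@layer_cat (odd l) 0 l n.+1) ?(@layer_cat (odd l) l l.+1 n.+1);
  try lia.
rewrite layerSl eqxx (_ : odd l == ~~ odd l = false) ?mulg1; last by case: odd.
rewrite -!mulgA (mulgA (desc _ _)).
have -> : desc l.+1 n.+1 * layer (odd l) 0 l = layer (odd l) 0 l * desc l.+1
  n.+1.
  apply: commute_layer => i il oi; apply/commute_sym/commute_desc => j jl.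
  by apply: xC; lia.
rewrite -[_ * desc _ _ * _]mulgA (mulgA (desc _ _)) -descSl -desc_cat;
  last by lia.
rewrite desc_layer // (@layer_cat (~~ odd l) 0 l n) // -!mulgA; congr (_ * _).
rewrite !mulgA; congr (_ * _).
apply/commute_layer => i il oi; apply/commute_sym/commute_layer => j jl oj.
apply/commute_sym/xC; lia.
Qed.

Definition alt_layer p n m := alt_prod (layer p 0 n) (layer (~~ p) 0 n) m.

Lemma alt_layerSr p n m :
  alt_layer p n m.+1 = alt_layer p n m * layer (p (+) odd m) 0 n.
Proof.
rewrite /alt_layer alt_prodSr; congr (_ * _).
by case: (odd m); rewrite ?addbT ?addbF.
Qed.

(* Pulls to the right end the strand that enters last: it crosses one site per
   layer, moving left from site [n]. *)
Lemma alt_layer_wire p n m : n < N -> m <= n + (odd n != p) ->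
  alt_layer p n.+1 m.+1 =
  alt_layer p n m * layer (p (+) odd m) 0 (n + (odd n != p) - m) *
    desc (n + (odd n != p) - m) n.+1.
Proof.
move=> nN; elim: m => [_|m IHm lt_m].
  (* The first layer meets site [n] only if [odd n == p]; otherwise the strand enters one layer
     later, whence the delay [odd n != p]. *)
  rewrite /alt_layer /= mulg1 mul1g subn0 addbF.
  have [<-|np] /= := eqVneq (odd n) p; last by rewrite addn1 desc_nil mulg1.
  by rewrite addn0 descSl (@layer_cat _ 0 n n.+1) ?leqnSn // layerSl eqxx.
rewrite alt_layerSr (IHm (ltnW lt_m)).
set l := n + (odd n != p) - m.+1.
have -> : n + (odd n != p) - m = l.+1 by lia.
have pm : p (+) odd m = ~~ odd l.
  by rewrite oddB // oddD oddS; clear; case: (odd n); case: p; case: (odd m).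
have pm1 : p (+) odd m.+1 = odd l by rewrite /= addbN pm negbK.
rewrite pm1 [in RHS]alt_layerSr pm -!mulgA (mulgA (layer _ _ l.+1))
  layer_desc_step //; last by lia.
by rewrite -!mulgA.
Qed.

(** The fundamental element on [n.+1] sites is the one on [n] sites times a full strand. *)
Lemma alt_layerS p n : n < N ->
  alt_layer p n.+1 n.+2 = alt_layer p n n.+1 * desc 0 n.+1.
Proof.
move=> nN; have [np|np] := eqVneq (odd n) p.
  (* Without delay the strand is complete one layer early. The last layer then consists of odd
     sites, so it avoids site 0 and slides through the strand. *)
  rewrite alt_layerSr alt_layer_wire //; last by rewrite leq_addr.
  rewrite np eqxx addn0 subnn layer_nil mulg1 -mulgA /= addbN np addbb /=.
  rewrite (@layer_cat _ 0 1 n.+1) // layerSl /= mul1g desc_layer // mulgA.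
  by rewrite alt_layerSr np addbb.
rewrite alt_layer_wire ?np ?addn1 //.
by rewrite subnn layer_nil mulg1.
Qed.

(** By induction, since the strand split off by [alt_layerS] does not depend on the colour [p]. *)
Lemma alt_layer_negb p n : n <= N -> alt_layer p n n.+1 = alt_layer (~~ p) n
  n.+1.
Proof.
elim: n => [_|n IHn nN]; last by rewrite !alt_layerS // IHn // ltnW.
by rewrite /alt_layer /= !mulg1 !layer_nil.
Qed.

End BraidPath.

(** * Least common multiples of disjoint paths *)

Section LeftDivision.

Variable M : monoidType.
Implicit Types x y z : M.

Definition ldvd x y := exists z, y = x * z.

Lemma ldvd_mulr x y : ldvd x (x * y).
Proof. by exists y. Qed.

Lemma ldvd_trans x y z : ldvd x y -> ldvd y z -> ldvd x z.
Proof. by move=> [a ->] [b ->]; exists (a * b); rewrite mulgA. Qed.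

Lemma ldvd_mul2l x y z : ldvd y z -> ldvd (x * y) (x * z).
Proof. by move=> [a ->]; exists a; rewrite mulgA. Qed.

(** A coprimality in the style of Gauss's lemma. It holds for generators that are far apart, and
    products in [y] preserve it, so it passes to layers and strands. *)
Definition ldvd_cancel x y := forall z, ldvd x (y * z) -> ldvd x z.

Lemma ldvd_cancel1 x : ldvd_cancel x 1.
Proof. by move=> z; rewrite mul1g. Qed.

Lemma ldvd_cancelM x y z :
  ldvd_cancel x y -> ldvd_cancel x z -> ldvd_cancel x (y * z).
Proof. by move=> xy xz w; rewrite -mulgA => /xy/xz. Qed.

Lemma ldvd_cancel_alt_prod x a b m :
  ldvd_cancel x a -> ldvd_cancel x b -> ldvd_cancel x (alt_prod a b m).
Proof.
elim: m a b => [|m IHm] a b xa xb; first exact: ldvd_cancel1.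
by apply: ldvd_cancelM => //; apply: IHm.
Qed.

Lemma ldvd_cancel_prod (I : Type) (r : seq I) (P : pred I) (F : I -> M) x :
  (forall i, P i -> ldvd_cancel x (F i)) ->
  ldvd_cancel x (\prod_(i <- r | P i) F i).
Proof. exact: (big_ind _ (@ldvd_cancel1 x) (@ldvd_cancelM x)). Qed.

Lemma ldvd_cancel_layer (f : nat -> M) p k n x :
  (forall i, k <= i < n -> ldvd_cancel x (f i)) ->
  ldvd_cancel x (layer f p k n).
Proof.
move=> xf; rewrite /layer big_nat_cond; apply: ldvd_cancel_prod => i.
by move=> /andP[ikn _]; apply: xf.
Qed.

Lemma ldvd_cancel_desc (f : nat -> M) k n x :
  (forall i, k <= i < n -> ldvd_cancel x (f i)) ->
  ldvd_cancel x (desc f k n).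
Proof.
move=> xf; rewrite /desc big_seq_cond; apply: ldvd_cancel_prod => i.
by rewrite mem_rev mem_index_iota andbT => /xf.
Qed.

Lemma ldvd_cancel_alt_layer (f : nat -> M) p n m x :
  (forall i, i < n -> ldvd_cancel x (f i)) ->
  ldvd_cancel x (alt_layer f p n m).
Proof. by move=> xf; apply: ldvd_cancel_alt_prod; apply: ldvd_cancel_layer. Qed.

End LeftDivision.

Section SmallTypeLcm.

Variable H : coxeterGraph.
Hypotheses (smallH : small_type H) (no_triangleH : no_triangle H).
Implicit Types (s t : H).

Local Notation g := (@artin_gen H).

Definition far s t := (s != t) && ~~ cox_edge s t.

Lemma farC s t : far s t = far t s.
Proof. by rewrite /far eq_sym cox_edgeC. Qed.

Lemma far_commute s t : far s t -> commute (g s) (g t).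
Proof. by move=> /andP[_ /(artin_gen_commute smallH)]. Qed.

Lemma far_ldvd_cancel s t : far s t -> ldvd_cancel (g s) (g t).
Proof.
move=> /andP[st nst] z [y /(gen_mul_eq smallH no_triangleH)[w [-> _]]].
rewrite /gen_compl eq_sym (negPf st) cox_edgeC (negPf nst).
exact: ldvd_mulr.
Qed.

Lemma edge_ldvd s t z : cox_edge s t -> ldvd (g s) (g t * z) ->
  ldvd (g s * g t) z.
Proof.
move=> st [y /(gen_mul_eq smallH no_triangleH)[w [-> _]]].
have nst : t != s by move: st; rewrite /cox_edge eq_sym => /andP[].
by rewrite /gen_compl (negPf nst) cox_edgeC st; apply: ldvd_mulr.
Qed.

Section Path.

Variables (N : nat) (f : nat -> H).
Hypothesis f_far : forall i j, i.+1 < j -> j < N -> far (f i) (f j).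
Hypothesis f_edge : forall i, i.+1 < N -> cox_edge (f i) (f i.+1).

Let x i := g (f i).

Let xC i j : i.+1 < j -> j < N -> commute (x i) (x j).
Proof. by move=> ij jN; apply/far_commute/f_far. Qed.

Let xB i : i.+1 < N -> x i * x i.+1 * x i = x i.+1 * x i * x i.+1.
Proof. by move=> iN; apply/artin_gen_braid/f_edge. Qed.

Let x_cancel i j : i.+1 < j -> j < N -> ldvd_cancel (x j) (x i).
Proof. by move=> ij jN; apply: far_ldvd_cancel; rewrite farC f_far. Qed.

(** The lcm of two neighbouring sites brings out [x n.+1 * x n]. Since [x n.+1] commutes with the
    sites below [n] and is coprime to them, it divides [z]; cancelling it leaves the same statement
    one site lower. *)
Lemma ldvd_desc n z : n < N -> ldvd (x n) (desc x 0 n * z) ->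
  ldvd (desc x 0 n.+1) z.
Proof.
elim: n z => [|n IHn] z nN; first by rewrite desc_nil descSl mul1g.
rewrite (@desc_cat _ x 0 n n.+1) ?leqnSn // descSl -mulgA => div_n.
have [|w zw] := edge_ldvd _ div_n; first by rewrite cox_edgeC f_edge.
have : ldvd (x n.+1) (desc x 0 n * z) by exists (x n * w); rewrite zw mulgA.
have canc : ldvd_cancel (x n.+1) (desc x 0 n).
  by apply: ldvd_cancel_desc => i /andP[_ lin]; apply: x_cancel.
move=> /canc[y zy].
move: zw; rewrite {}zy mulgA.
have <- : commute (x n.+1) (desc x 0 n).
  by apply: commute_desc => i /andP[_ lin]; apply/commute_sym/xC.
rewrite -!mulgA => /(artin_mulIl smallH no_triangleH) dnw.
have [|v ->] := IHn y (ltnW nN); first by exists w.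
exists v; rewrite (@desc_cat _ x 0 n.+1 n.+2) ?leqnSn // descSl mulgA.
by [].
Qed.

(** Adding the last site: the fundamental element of the previous sites is split by [alt_layerS],
    its first factor is coprime to the new site, and [ldvd_desc] handles the strand. *)
Lemma ldvd_alt_layer p n z : n <= N -> (forall i, i < n -> ldvd (x i) z) ->
  ldvd (alt_layer x p n n.+1) z.
Proof.
elim: n => [|n IHn] nN xz.
  by rewrite /alt_layer /= mulg1 layer_nil; exists z; rewrite mul1g.
have [||y zy] := IHn; [exact: ltnW | by move=> i /ltnW/xz |].
rewrite (alt_layerS xC xB) // zy; apply/ldvd_mul2l/ldvd_desc => //.
have := xz n (ltnSn n); rewrite {xz}zy; case: n => [|n] in nN {IHn} *.
  by rewrite /alt_layer /= mulg1 layer_nil desc_nil.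
rewrite (alt_layerS xC xB) -1?(mulgA (alt_layer _ _ _ _)); last exact: ltnW.
have canc : ldvd_cancel (x n.+1) (alt_layer x p n n.+1).
  by apply: ldvd_cancel_alt_layer => i lin; apply: x_cancel.
exact: canc.
Qed.

End Path.

Section Paths.

Variables (K : eqType) (r : seq K) (n : nat) (f : K -> nat -> H) (p : pred K).
Hypothesis uniq_r : uniq r.
Hypothesis f_far : forall k i j, i.+1 < j -> j < n -> far (f k i) (f k j).
Hypothesis f_edge : forall k i, i.+1 < n -> cox_edge (f k i) (f k i.+1).
Hypothesis f_sep : forall k k' i j, k != k' -> i < n -> j < n ->
  far (f k i) (f k' j).

Let x k i := g (f k i).

Let xC k i j : i.+1 < j -> j < n -> commute (x k i) (x k j).
Proof. by move=> ij jn; apply/far_commute/f_far. Qed.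

Let xB k i : i.+1 < n -> x k i * x k i.+1 * x k i = x k i.+1 * x k i * x k i.+1.
Proof. by move=> iN; apply/artin_gen_braid/f_edge. Qed.

Let layersC k k' b b' : k != k' ->
  commute (layer (x k) b 0 n) (layer (x k') b' 0 n).
Proof.
move=> kk'; apply: commute_layer => i ilt _.
apply/commute_sym/commute_layer => j jlt _.
by apply/far_commute/f_sep => //; rewrite eq_sym.
Qed.

(** One colour class of all the paths; [p k] exchanges the two colours on the path [k]. *)
Definition layers (b : bool) := \prod_(k <- r) layer (x k) (b (+) p k) 0 n.

Lemma alt_prod_layers b m : alt_prod (layers b) (layers (~~ b)) m =
  \prod_(k <- r) alt_layer (x k) (b (+) p k) n m.
Proof.
rewrite /layers; elim: r uniq_r => [_|k r' IHr /= /andP[kr' ur']].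
  rewrite !big_nil; elim: m => //= m; rewrite !mul1g; elim: m => //= m.
rewrite !big_cons alt_prodM ?IHr // /alt_layer -?addNb //.
all: apply: commute_sym; rewrite big_seq_cond; apply: commute_prod => k'.
all: rewrite andbT => k'r; apply: layersC.
all: by apply: contraNneq kr' => ->.
Qed.

Lemma alt_prod_layersC b :
  alt_prod (layers b) (layers (~~ b)) n.+1 =
  alt_prod (layers (~~ b)) (layers b) n.+1.
Proof.
rewrite alt_prod_layers -[in X in _ = alt_prod _ X _](negbK b) alt_prod_layers.
by apply: eq_bigr => k _; rewrite (alt_layer_negb (@xC k) (@xB k)) // addNb.
Qed.

(** The fundamental elements of the paths are divided out one at a time; each is coprime to the
    vertices of the other paths. *)
Lemma ldvd_alt_prod_layers b z :
    (forall k i, k \in r -> i < n -> ldvd (x k i) z) ->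
  ldvd (alt_prod (layers b) (layers (~~ b)) n.+1) z.
Proof.
rewrite alt_prod_layers; elim: r uniq_r z => [_|k r' IHr /= /andP[kr' ur']] z
  xz.
  by rewrite big_nil; exists z; rewrite mul1g.
have [|y zy] := @ldvd_alt_layer n (f k) (@f_far k) (@f_edge k) (b (+) p k) n z
  (leqnn n).
  by move=> i; apply: xz; rewrite mem_head.
rewrite big_cons zy; apply/ldvd_mul2l/IHr => // k' i k'r lin.
have canc : ldvd_cancel (x k' i) (alt_layer (x k) (b (+) p k) n n.+1).
  apply: ldvd_cancel_alt_layer => j ltj; apply/far_ldvd_cancel/f_sep => //.
  by apply: contraNneq kr' => <-.
by apply: canc; rewrite -zy; apply: xz; rewrite // inE k'r orbT.
Qed.

End Paths.

End SmallTypeLcm.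

(** * The numbers game *)

Section NumbersGame.

Variable H : coxeterGraph.
Hypothesis smallH : small_type H.
Implicit Types (s t : H) (v : H -> int).

Import GRing.Theory Num.Theory Order.Theory.
Local Open Scope ring_scope.

(* Unlike a reflection, firing [s] is not invertible: it always leaves a
   nonpositive label at [s]. *)
Definition fire s v : H -> int := fun t =>
  if v s <= 0 then v t else
  if t == s then - v s else if cox_edge s t then v t + v s else v t.

Definition fires (u : seq H) v := foldr fire v u.

Lemma fire_le0 s v : fire s v s <= 0.
Proof. by rewrite /fire eqxx; case: ifP => //; lia. Qed.

Lemma eq_fire s v w : v =1 w -> fire s v =1 fire s w.
Proof. by move=> vw t; rewrite /fire !vw. Qed.

Lemma eq_fires u v w : v =1 w -> fires u v =1 fires u w.
Proof. by elim: u => //= s u IHu /IHu/eq_fire; apply. Qed.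

Lemma fires_cat u u' v : fires (u ++ u') v = fires u (fires u' v).
Proof. exact: foldr_cat. Qed.

Lemma fire_commute s t v : s != t -> ~~ cox_edge s t ->
  fire s (fire t v) =1 fire t (fire s v).
Proof.
move=> st nst; have nts : ~~ cox_edge t s by rewrite cox_edgeC.
move=> z; rewrite /fire.
rewrite ?eqxx (negPf st) [t == s]eq_sym (negPf st) (negPf nst) (negPf nts).
have [->|zs] := eqVneq z s.
  rewrite (negPf st) (negPf nts); move: (v s) (v t) => a b; clear;
    do !case: ifP; lia.
have [->|zt] := eqVneq z t.
  rewrite (negPf nst); move: (v s) (v t) => a b; clear; do !case: ifP; lia.
by case: (cox_edge s z); case: (cox_edge t z); move: (v s) (v t) (v z) => a b c;
  clear; do !case: ifP; lia.
Qed.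

(** Firing is piecewise linear, and the identity is checked for each sign pattern of the labels. *)
Lemma fire_braid s t v : cox_edge s t ->
  fire s (fire t (fire s v)) =1 fire t (fire s (fire t v)).
Proof.
move=> est; have ets : cox_edge t s by rewrite cox_edgeC.
have st : s != t by case/andP: est.
move=> z; rewrite /fire.
rewrite ?eqxx (negPf st) [t == s]eq_sym (negPf st) est ets.
have [->|zs] := eqVneq z s.
  rewrite (negPf st) ets; move: (v s) (v t) => a b; clear; do !case: ifP; lia.
have [->|zt] := eqVneq z t.
  rewrite est; move: (v s) (v t) => a b; clear; do !case: ifP; lia.
by case: (cox_edge s z); case: (cox_edge t z); move: (v s) (v t) (v z) => a b c;
  clear; do !case: ifP; lia.
Qed.

Lemma eq_artin_cong_fires u u' v : artin_cong u u' -> fires u v =1 fires u' v.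
Proof.
move=> uu'; elim: uu' v => {u u'} [s t m st mst|u|u u' _ IH|u u' u'' _ IH _ IH'|
    u u' w w' _ IHu _ IHw] v z //.
- move: mst; rewrite small_label //; case: ifP => est -[<-] /=;
    first exact: fire_braid.
  by apply: fire_commute; rewrite ?est.
- by rewrite IH.
- by rewrite IH IH'.
by rewrite !fires_cat IHu; apply: eq_fires.
Qed.

(** Letters are fired from right to left, so a word starting with [s] fires [s] last. *)
Lemma ldvd_fires_le0 s u v : ldvd (artin_gen s) (artin_word u) ->
  fires u v s <= 0.
Proof.
case=> z; rewrite -(artin_word_repr z) -artin_word_cons => /artin_wordP.
by move/eq_artin_cong_fires->; apply: fire_le0.
Qed.

Variable P : pred H.
Hypothesis P_deg : forall s, P s -> exists a b,
  [/\ P a, P b, a != b, cox_edge s a & cox_edge s b].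

(** Firing a positive [s] in [P] loses [2 * v s] at [s] and gains [v s] at each of at least two
    neighbours in [P]; firing outside [P] can only increase the labels in [P]. *)
Lemma sum_fire s v : \sum_(t | P t) v t <= \sum_(t | P t) fire s v t.
Proof.
have [vs|vs] := lerP (v s) 0.
  by rewrite /fire vs.
have vs' : (v s <= 0) = false by rewrite leNgt vs.
have fireE t : t != s -> v t <= fire s v t.
  by move=> ts; rewrite /fire vs' (negPf ts); case: ifP; lia.
have [Ps|nPs] := boolP (P s); last first.
  apply: ler_sum => t Pt; apply: fireE; by apply: contraNneq nPs => <-.
have [a [b [Pa Pb ab sa sb]]] := P_deg Ps.
have as_ : a != s by move: sa; rewrite eq_sym => /andP[].
have bs : b != s by move: sb; rewrite eq_sym => /andP[].
rewrite !(bigD1 s Ps) /= !(bigD1 a (P := fun i => P i && (i != s))) ?Pa //=.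
rewrite !(bigD1 b (P := fun i => P i && (i != s) && (i != a))) ?Pb ?bs 1?eq_sym
  ?ab //=.
have : \sum_(i | P i && (i != s) && (i != a) && (i != b)) v i <=
       \sum_(i | P i && (i != s) && (i != a) && (i != b)) fire s v i.
  by apply: ler_sum => t /andP[/andP[/andP[_ /fireE]]].
rewrite /fire vs' eqxx (negPf as_) (negPf bs) sa sb.
set X := \sum_(i | _) _; set Y := \sum_(i | _) _.
lia.
Qed.

(** Starting from the constant label 1, the sum over [P] stays positive, whereas a common multiple
    would leave only nonpositive labels on [P]. *)
Lemma no_common_multiple u : (exists s, P s) ->
  ~ (forall s, P s -> ldvd (artin_gen s) (artin_word u)).
Proof.
move=> [s0 Ps0] div.
have le1 : \sum_(t | P t) 1 <= \sum_(t | P t) fires u (fun _ => 1) t :> int.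
  by elim: (u) => //= s w IHw; apply: le_trans IHw (sum_fire _ _).
have le2 : \sum_(t | P t) fires u (fun _ => 1) t <= 0.
  by apply: sumr_le0 => t Pt; apply/ldvd_fires_le0/div.
have : (0 : int) < \sum_(t | P t) 1.
  rewrite (bigD1 s0 Ps0) /=; apply: ltr_pwDl => //.
  by apply: sumr_ge0.
by rewrite ltNge (le_trans le1 le2).
Qed.

End NumbersGame.

(** * Morphisms respecting lcms *)

Lemma label_ge2 (G : coxeterGraph) (s t : G) m :
  s != t -> cox_matrix G s t = Some m -> 1 < m.
Proof. by move=> /(cox_offdiag (cox_matrix G)) + st; rewrite st. Qed.

Section LcmMorphism.

Variables (G : coxeterGraph) (M : monoidType) (T : G -> M).
Implicit Types (a u v : seq G).

Hypothesis mulIl : forall x : M, injective (fun y => x * y).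
Hypothesis T_neq1 : forall s y, T s * y <> 1.
Hypothesis T_alt : forall s t m, s != t -> cox_matrix G s t = Some m ->
  alt_prod (T s) (T t) m = alt_prod (T t) (T s) m.
Hypothesis T_lcm : forall s t z, s != t -> ldvd (T s) z -> ldvd (T t) z ->
  exists2 m, cox_matrix G s t = Some m & ldvd (alt_prod (T s) (T t) m) z.

Definition word_image u : M := \prod_(s <- u) T s.

Lemma word_image_cons s u : word_image (s :: u) = T s * word_image u.
Proof. exact: big_cons. Qed.

Lemma word_image_cat u v : word_image (u ++ v) = word_image u * word_image v.
Proof. exact: big_cat. Qed.

Lemma word_image_alt s t m :
  word_image (alt_word s t m) = alt_prod (T s) (T t) m.
Proof.
elim: m s t => [|m IHm] s t; first exact: big_nil.
by rewrite /= word_image_cons IHm.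
Qed.

Lemma word_image_cong u v : artin_cong u v -> word_image u = word_image v.
Proof.
elim=> {u v} [s t m st mst|//|//|u v w _ -> _ -> //|u u' v v' _ uu' _ vv'].
  by rewrite !word_image_alt T_alt.
by rewrite !word_image_cat uu' vv'.
Qed.

(** Induction on the length of [u]: once [u] is rewritten to start with the first letter of [a],
    this letter is cancelled on both sides. *)
Lemma word_image_ldvd a u : ldvd (word_image a) (word_image u) ->
  exists v, artin_cong u (a ++ v).
Proof.
have [n] := ubnP (size u); elim: n => // n IHn in a u *; rewrite ltnS => un.
case: a => [_|s a]; first by exists u; apply: artin_refl.
case: u un => [_ [y]|t u un].
  by rewrite word_image_cons /word_image big_nil -mulgA => /esym/T_neq1.
rewrite word_image_cons => sa_tu.
have s_tu : ldvd (T s) (word_image (t :: u)).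
  by apply: ldvd_trans sa_tu; apply: ldvd_mulr.
have [w tu_sw] : exists w, artin_cong (t :: u) (s :: w).
  have [->|st] := eqVneq s t; first by exists u; apply: artin_refl.
  (* Cancelling [T t] from the lcm shows that the alternating word of length [m - 1] starting with
     [s] divides [u]; the Artin relation then turns the head [t] into [s]. *)
  have [|m mst] := T_lcm st s_tu; first by rewrite word_image_cons;
    apply: ldvd_mulr.
  have m2 := label_ge2 st mst; rewrite (T_alt st mst) word_image_cons.
  case: m m2 mst => // m _ mst /= [y]; rewrite -mulgA => /mulIl uy.
  have [|v uv] := IHn (alt_word s t m) u un.
    by exists y; rewrite word_image_alt.
  exists (alt_word t s m ++ v); apply: artin_trans (artin_cat (artin_refl [::
    t]) uv) _.
  exact: artin_cat (artin_sym (artin_rel st mst)) (artin_refl v).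
move: sa_tu; rewrite (word_image_cong tu_sw) word_image_cons => -[y].
rewrite -mulgA => /mulIl ay.
have [||v wv] := IHn a w; last first.
- exists v; apply: artin_trans tu_sw _.
  exact: artin_cat (artin_refl [:: s]) wv.
- by exists y.
by have /= [<-] := size_artin_cong tu_sw.
Qed.

Lemma word_image_inj u v : word_image u = word_image v -> artin_cong u v.
Proof.
move=> uv; have [|w vw] := @word_image_ldvd u v.
  by exists 1; rewrite mulg1.
have := word_image_cong vw; rewrite -uv word_image_cat -[LHS]mulg1 => /mulIl.
case: w vw => [|s w] vw; first by rewrite cats0 in vw => _; apply: artin_sym.
by rewrite word_image_cons => /esym/T_neq1.
Qed.

Lemma lcm_morphism : exists2 phi : artinMonoid G -> M,
  monoid_morphism phi & injective phi.
Proof.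
exists (fun x => word_image (repr x)).
  split=> [|x y].
    have <- : word_image [::] = 1 by apply: big_nil.
    apply/word_image_cong/artin_wordP.
    exact: artin_word_repr.
  rewrite -word_image_cat; apply/word_image_cong/artin_wordP.
  by rewrite artin_word_repr.
move=> x y /word_image_inj/artin_wordP; by rewrite !artin_word_repr.
Qed.

End LcmMorphism.

(** Used to extract one vertex from the product of a fibre and to regroup a fibre by paths. *)
Lemma prodg_perm_commute (M : monoidType) (I : eqType) (F : I -> M) l1 l2 :
  (forall i j, i \in l1 -> j \in l1 -> commute (F i) (F j)) -> perm_eq l1 l2 ->
  \prod_(i <- l1) F i = \prod_(i <- l2) F i.
Proof.
elim: l1 l2 => [|i l1 IHl] l2 cF; first by rewrite perm_sym => /perm_nilP->.
move=> il; have /splitPr il2 : i \in l2 by rewrite -(perm_mem il) mem_head.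
case: l2 / il2 il => a b.
rewrite perm_sym (perm_catCA a [:: i] b) /= perm_cons perm_sym => l1ab.
rewrite big_cons (IHl _ _ l1ab) => [|j k jl kl]; last first.
  by apply: cF; rewrite inE ?jl ?kl orbT.
rewrite !big_cat big_cons /= !mulgA; congr (_ * _).
rewrite big_seq; apply: commute_prod => j ja; apply: cF; first exact: mem_head.
by rewrite inE (perm_mem l1ab) mem_cat ja orbT.
Qed.

(** * The small type graph *)

Section SimpleGraph.

Variables (V : finType) (e : rel V).
Hypothesis e_sym : symmetric e.

Definition simple_entry (x y : V) : cox_label :=
  Some (if x == y then 1 else if e x y then 3 else 2)%N.

Fact simple_entry_diag x : simple_entry x x = Some 1%N.
Proof. by rewrite /simple_entry eqxx. Qed.

Fact simple_entry_sym x y : simple_entry x y = simple_entry y x.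
Proof. by rewrite /simple_entry eq_sym e_sym. Qed.

Fact simple_entry_offdiag x y : x != y -> label_ge 2 (simple_entry x y).
Proof. by rewrite /simple_entry => /negPf->; case: ifP. Qed.

Definition simple_graph := CoxeterGraph
  (CoxeterMatrix simple_entry_diag simple_entry_sym simple_entry_offdiag).

Lemma simple_graph_small : small_type simple_graph.
Proof.
move=> x y /negPf xy; rewrite /= /simple_entry xy.
by case: ifP => _; [right | left].
Qed.

Lemma simple_graph_edge (x y : simple_graph) : cox_edge x y = (x != y) && e x y.
Proof.
by rewrite /cox_edge /= /simple_entry; case: eqVneq => //= _; case: ifP.
Qed.

End SimpleGraph.

(** * The unfolded graph of [G] and the products over its fibres *)

Section Unfolding.

Variable G : coxeterGraph.
Implicit Types (s t : G) (q : G * G).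

Local Notation m := (cox_matrix G).

(* The enumeration order of the vertices represents unordered pairs. *)
Definition pair_key s t : G * G :=
  if enum_rank s < enum_rank t then (s, t) else (t, s).

Lemma pair_keyC s t : pair_key s t = pair_key t s.
Proof. by rewrite /pair_key; case: ltngtP => // /val_inj/enum_rank_inj->. Qed.

Lemma pair_key_inj s t s' t' : pair_key s t = pair_key s' t' ->
  (s = s' /\ t = t') \/ (s = t' /\ t = s').
Proof. by rewrite /pair_key; do 2!case: ifP => _; case=> -> ->; auto. Qed.

(* Finite labels give the path of type A_(m-1); an infinite label gives the
   triangle, whose bipartite double cover is the 6-cycle. *)
Definition last_site q : nat := if m q.1 q.2 is Some k then k.-2 else 2.

Definition site_adj (l : cox_label) (c d : nat) : bool :=
  if l is Some _ then (d == c.+1) || (c == d.+1) else c != d.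

Definition unf_index := {dffun forall q, 'I_(last_site q).+1}.

Definition unf_vertex : finType := (G * unf_index)%type.

Implicit Types (i j : unf_index) (x y : unf_vertex).

Definition unf_adj x y :=
  let k := pair_key x.1 y.1 in
  [&& x.1 != y.1, site_adj (m x.1 y.1) (x.2 k) (y.2 k) &
      [forall q, (q != k) ==> (x.2 q == y.2 q)]].

Lemma unf_adj_sym : symmetric unf_adj.
Proof.
suff imp x y : unf_adj x y -> unf_adj y x by move=> x y; apply/idP/idP;
  apply: imp.
rewrite /unf_adj pair_keyC eq_sym cox_sym => /and3P[-> adj /forallP eq_xy] /=.
apply/andP; split; first by case: (m _ _) adj => [k|];
  rewrite /= 1?orbC 1?eq_sym.
by apply/forallP => q; rewrite [y.2 q == _]eq_sym.
Qed.

Definition unf_graph := simple_graph unf_adj_sym.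

Lemma unf_edge (x y : unf_graph) : cox_edge x y = unf_adj x y.
Proof.
rewrite simple_graph_edge; case: eqVneq => //= ->.
by rewrite /unf_adj eqxx.
Qed.

Lemma last_site_key s t :
  last_site (pair_key s t) = if m s t is Some k then k.-2 else 2.
Proof. by rewrite /last_site /pair_key; case: ifP => // _ /=;
  rewrite cox_sym. Qed.

(** An edge changes the site at its own key only, and the three keys of a triangle are distinct. So
    [z] agrees with [x] and with [y] at the key of [x] and [y], where these two must differ. *)
Lemma unf_graph_no_triangle : no_triangle unf_graph.
Proof.
case=> x [y [z []]]; rewrite !unf_edge => /and3P[xy adj _].
move=> /and3P[xz _ /forallP/(_ (pair_key x.1 y.1)) eq_xz].
move=> /and3P[yz _ /forallP/(_ (pair_key x.1 y.1)) eq_yz].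
move: adj eq_xz eq_yz.
have [/pair_key_inj|_] := eqVneq (pair_key x.1 y.1) (pair_key x.1 z.1).
  by case=> [[_ e]|[e _]]; rewrite e eqxx in yz xz.
have [/pair_key_inj|_ /=] := eqVneq (pair_key x.1 y.1) (pair_key y.1 z.1).
  by case=> [[e _]|[e _]]; rewrite e eqxx in xy xz.
move=> adj /eqP eq_xz /eqP eq_yz; move: adj; rewrite eq_xz eq_yz.
by case: (m _ _) => [k|] /=; rewrite ?eqxx // eqn_leq ltnn andbF.
Qed.

(** Out of range, [inord] gives the site 0, whence the bound in [set_site_in]. *)
Definition set_site i q (c : nat) : unf_index :=
  finfun (fun q' => dfwith (fun q'' => i q'') (inord c : 'I_(last_site q).+1)
    q').

Lemma set_site_in i q c : c <= last_site q -> set_site i q c q = c :> nat.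
Proof. by move=> cq; rewrite ffunE dfwith_in inordK. Qed.

Lemma set_site_out i q c q' : q != q' -> set_site i q c q' = i q'.
Proof. by move=> qq'; rewrite ffunE dfwith_out. Qed.

Definition fiber s : seq unf_graph := [seq (s, i) | i <- enum unf_index].

Lemma mem_fiber s x : (x \in fiber s) = (x.1 == s).
Proof.
apply/mapP/eqP => [[i _ ->] //|<-]; exists x.2; first by rewrite mem_enum.
by case: x.
Qed.

Lemma fiber_uniq s : uniq (fiber s).
Proof. by rewrite map_inj_uniq ?enum_uniq // => i j []. Qed.

Definition fiber_prod s : artinMonoid unf_graph :=
  \prod_(x <- fiber s) artin_gen x.

Lemma fiber_commute s (x y : unf_graph) : x \in fiber s -> y \in fiber s ->
  commute (artin_gen x) (artin_gen y).
Proof.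
rewrite !mem_fiber => /eqP xs /eqP ys.
apply: artin_gen_commute; first exact: simple_graph_small.
by rewrite unf_edge /unf_adj xs ys eqxx.
Qed.

Lemma fiber_prod_ldvd s (x : unf_graph) : x \in fiber s ->
  ldvd (artin_gen x) (fiber_prod s).
Proof.
move=> xs; rewrite /fiber_prod (prodg_perm_commute _ (perm_to_rem xs)).
  by rewrite big_cons; apply: ldvd_mulr.
exact: fiber_commute.
Qed.

(** * Common multiples of the products of two fibres *)

Section Pair.

Variables s t : G.
Hypothesis st : s != t.

Let k := pair_key s t.

Lemma no_fiber_lcm z : m s t = None -> ldvd (fiber_prod s) z ->
  ~ ldvd (fiber_prod t) z.
Proof.
move=> mst sz tz; have lk : last_site k = 2 by rewrite last_site_key mst.
pose P (x : unf_graph) := (x.1 == s) || (x.1 == t).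
rewrite -(artin_word_repr z) in sz tz.
apply: (no_common_multiple (@simple_graph_small _ _ unf_adj_sym) (P :=
  P)) (repr z) _ _.
(* The two neighbours of [x] in its 6-cycle have the other colour [r] and lie at the two other sites
   modulo 3. *)
- move=> x Px; pose r := if x.1 == s then t else s.
  pose a c : unf_graph := (r, set_site x.2 k ((x.2 k + c) %% 3)).
  have xk : x.2 k < 3 by rewrite -[3]/2.+1 -[in X in _ < X.+1]lk.
  have ac c : (a c).2 k = (x.2 k + c) %% 3 :> nat.
    rewrite set_site_in //; have : (x.2 k + c) %% 3 <= 2 by rewrite -ltnS
      ltn_pmod.
    by move/leq_trans; apply; rewrite lk.
  have mxr : m x.1 r = None /\ pair_key x.1 r = k /\ x.1 != r.
    rewrite /r; case: eqP => [->|/eqP xs] //.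
    move: Px; rewrite /P (negPf xs) => /eqP xt.
    by rewrite /= xt cox_sym pair_keyC.
  have xa c : 0 < c < 3 -> cox_edge x (a c).
    move=> c3; rewrite unf_edge /unf_adj; case: mxr => -> [-> ->] /=.
    rewrite ac; apply/andP; split.
      by rewrite /=; move: (nat_of_ord _) xk c3 => e; lia.
    by apply/forallP => q; apply/implyP => qk; rewrite set_site_out // eq_sym.
  exists (a 1%N), (a 2); split; try exact: xa.
  + by rewrite /P /= /r; case: ifP; rewrite eqxx ?orbT.
  + by rewrite /P /= /r; case: ifP; rewrite eqxx ?orbT.
  + apply/eqP => /(congr1 (fun y : unf_vertex => val (y.2 k))) /=.
    have := ac 1%N; have := ac 2; rewrite /= => -> ->; lia.
- by exists (s, [ffun q => ord0]); rewrite /P eqxx.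
move=> x /orP[] /eqP xs; [apply: ldvd_trans sz|apply: ldvd_trans tz];
  by apply: fiber_prod_ldvd; rewrite mem_fiber xs.
Qed.

(** * Finite label [n.+1]: disjoint paths with [n] sites *)

Section FiniteLabel.

Variable n : nat.
Hypothesis mst : m s t = Some n.+1.
Hypothesis n_gt0 : 0 < n.

Let lk : (last_site k).+1 = n.
Proof. by rewrite last_site_key mst /= prednK. Qed.

(** The site at [k] is normalised to 0, as it varies along a path; each path thus has a single
    index. *)
Let K : finType := ({i : unf_index | i k == ord0} * bool)%type.

(* A path of the double cover: [a.1] gives the sites at the other pairs, and
   [a.2] tells which of [s] and [t] colours the even sites. *)
Let f (a : K) (c : nat) : unf_graph :=
  (if odd c (+) a.2 then t else s, set_site (val a.1) k c).

Let f_site a c : c < n -> (f a c).2 k = c :> nat.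
Proof. by move=> cn; rewrite set_site_in // -ltnS lk. Qed.

Let f_eqP a b c d :
  reflect (forall q, q != k -> (f a c).2 q = (f b d).2 q) (a.1 == b.1).
Proof.
apply: (iffP eqP) => [eq_ab q qk|eq_ab].
  by rewrite /f /= eq_ab !set_site_out // eq_sym.
apply/val_inj/ffunP => q; have [->|qk] := eqVneq q k.
  by rewrite (eqP (valP a.1)) (eqP (valP b.1)).
by have := eq_ab q qk; rewrite !set_site_out // eq_sym.
Qed.

(** Consecutive sites have opposite parities, so distinct colours at consecutive sites amount to
    [a.2 = b.2]. *)
Let f_adj a b c d : c < n -> d < n ->
  unf_adj (f a c) (f b d) = (a == b) && ((d == c.+1) || (c == d.+1)).
Proof.
move=> cn dn.
have sF := negPf st; have tF := sF; rewrite eq_sym in tF.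
have fst_eq : ((f a c).1 == (f b d).1) = (odd c (+) a.2 == odd d (+) b.2).
  by rewrite /f /=; case: (_ (+) _); case: (_ (+) _); rewrite ?eqxx ?sF ?tF.
rewrite /unf_adj fst_eq.
have -> : (a == b) = (a.1 == b.1) && (a.2 == b.2) by [].
have [eq_par|neq_par] /= := eqVneq.
  apply/esym/negP => /andP[/andP[_ /eqP eq_ab] cd]; move: eq_par; rewrite eq_ab.
  by case/orP: cd => /eqP ->; rewrite /=; case: odd; case: b.2.
have [-> ->] : pair_key (f a c).1 (f b d).1 = k /\ m (f a c).1 (f b d).1 = Some
  n.+1.
  move: neq_par; rewrite /f /=; case: (_ (+) _); case: (_ (+) _) => // _.
  by rewrite pair_keyC cox_sym.
rewrite /site_adj !f_site // andbC.
have -> : [forall q, (q != k) ==> ((f a c).2 q == (f b d).2 q)] = (a.1 == b.1).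
  apply/forallP/(f_eqP a b c d) => eq_ab q; first by move=> qk;
    have /implyP/(_ qk)/eqP := eq_ab q.
  by apply/implyP => qk; apply/eqP/eq_ab.
case: (a.1 == b.1) => //=; case cd: (_ || _); last by rewrite andbF.
rewrite andbT; apply/esym; move: neq_par.
by case/orP: cd => /eqP ->; rewrite /=; case: odd; case: a.2; case: b.2.
Qed.

Let f_inj a b c d : c < n -> d < n -> f a c = f b d -> a = b /\ c = d.
Proof.
move=> cn dn eq_f; have eq_cd : c = d by rewrite -(f_site a cn) -(f_site b dn)
  eq_f.
split=> //; subst d; have eq1 : a.1 == b.1 by apply/(f_eqP a b c c) => q _;
  rewrite eq_f.
have : (f a c).1 = (f b c).1 by rewrite eq_f.
case: a b eq1 {eq_f} => [a1 a2] [b1 b2] /= /eqP->.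
case: (odd c); case: a2; case: b2 => //= e; move: st; by rewrite e eqxx.
Qed.

Let f_far a c d : c.+1 < d -> d < n -> far (f a c) (f a d).
Proof.
move=> cd dn; have cn : c < n by lia.
rewrite /far unf_edge f_adj // eqxx /=; apply/andP; split; last by lia.
by apply/eqP => /(f_inj cn dn)[_]; lia.
Qed.

Let f_edge a c : c.+1 < n -> cox_edge (f a c) (f a c.+1).
Proof. by move=> cn; rewrite unf_edge f_adj ?eqxx // ltnW. Qed.

Let f_sep a b c d : a != b -> c < n -> d < n -> far (f a c) (f b d).
Proof.
move=> ab cn dn; rewrite /far unf_edge f_adj // (negPf ab) andbT.
by apply/eqP => /(f_inj cn dn)[e _]; rewrite e eqxx in ab.
Qed.

Let F b := layers (H := unf_graph) (enum K) n f (fun a => a.2) b.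

(** The paths partition the vertices above [s] and [t], and the factors of a fibre commute, so their
    order is immaterial. *)
Let F_fiber b : fiber_prod (if b then t else s) = F b.
Proof.
rewrite /F /layers /layer /fiber_prod.
under [RHS]eq_bigr do rewrite -big_filter.
rewrite -(big_allpairs_dep (h := f)).
apply: prodg_perm_commute; first exact: fiber_commute.
apply: uniq_perm; first exact: fiber_uniq.
  apply: allpairs_uniq_dep; first exact: enum_uniq.
    by move=> a _; rewrite filter_uniq ?iota_uniq.
  move=> _ _ /allpairsPdep[a [c [_ + ->]]] /allpairsPdep[b' [d [_ + ->]]] /=.
  rewrite !mem_filter !mem_index_iota => /and3P[_ _ cn] /and3P[_ _ dn].
  by move=> /(f_inj cn dn)[-> ->].
move=> [u i]; rewrite mem_fiber /=; apply/eqP/allpairsPdep => [us|].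
  have i0 : set_site i k 0 k == ord0 by apply/eqP/val_inj;
    rewrite /= set_site_in.
  (* The position on the path is the site at [k]; the bit is the one giving the colour [b] at this
     position. *)
  exists (Sub (set_site i k 0) i0, odd (i k) (+) b), (i k : nat).
  rewrite mem_enum mem_filter mem_index_iota /= addbCA addbb addbF eqxx.
  have -> : i k < n by rewrite -[X in _ < X]lk.
  split=> //; rewrite us /f /= addbA addbb; congr (_, _).
  apply/ffunP => q; apply/val_inj; have [->|qk] := eqVneq q k.
    by rewrite /= set_site_in // -ltnS.
  by rewrite !set_site_out // eq_sym.
case=> a [c [_ + [-> _]]]; rewrite mem_filter => /andP[/eqP-> _].
by case: b; case: a.2.
Qed.

Lemma fiber_prod_alt : 
  alt_prod (fiber_prod s) (fiber_prod t) n.+1 =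
  alt_prod (fiber_prod t) (fiber_prod s) n.+1.
Proof.
have Fs : fiber_prod s = F false := F_fiber false.
have Ft : fiber_prod t = F true := F_fiber true.
rewrite Fs Ft /F.
exact: (alt_prod_layersC (@simple_graph_small _ _ unf_adj_sym) (fun a : K =>
  a.2)
  (enum_uniq _) f_far f_edge f_sep).
Qed.

Lemma fiber_prod_lcm z : ldvd (fiber_prod s) z -> ldvd (fiber_prod t) z ->
  ldvd (alt_prod (fiber_prod s) (fiber_prod t) n.+1) z.
Proof.
move=> sz tz.
have Fs : fiber_prod s = F false := F_fiber false.
have Ft : fiber_prod t = F true := F_fiber true.
rewrite Fs Ft /F.
apply: (ldvd_alt_prod_layers (@simple_graph_small _ _ unf_adj_sym)
  unf_graph_no_triangle (fun a : K => a.2) (enum_uniq _) f_far f_edge f_sep) =>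
    a c _ _.
have [tc|sc] := boolP (odd c (+) a.2).
  by apply: ldvd_trans tz; apply: fiber_prod_ldvd; rewrite mem_fiber /f /= tc.
by apply: ldvd_trans sz; apply: fiber_prod_ldvd; rewrite mem_fiber /f /= (negPf
  sc).
Qed.

End FiniteLabel.

End Pair.

End Unfolding.

Theorem theorem5p1 (G : coxeterGraph) :
  exists G' : coxeterGraph,
    [/\ small_type G', no_triangle G' &
      exists2 phi : artinMonoid G -> artinMonoid G',
        monoid_morphism phi & injective phi].
Proof.
have small := @simple_graph_small _ _ (@unf_adj_sym G).
exists (unf_graph G); split=> //; first exact: unf_graph_no_triangle.
apply: (@lcm_morphism _ _ (@fiber_prod G)).
- exact: (artin_mulIl small (@unf_graph_no_triangle G)).
(* Length is additive, and [fiber_prod s] is a multiple of a generator, here the vertex with all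
   sites 0. *)
- move=> s y; have [|z ->] := @fiber_prod_ldvd G s (s, [ffun q => ord0]).
    by rewrite mem_fiber.
  by move/(congr1 (@artin_len _)); rewrite !artin_lenM artin_len_gen artin_len1.
- move=> s t m st mst; have := label_ge2 st mst.
  by case: m mst => [|[|m]] // mst _; apply: (fiber_prod_alt st mst).
move=> s t z st sz tz; case mst: (cox_matrix G s t) => [m|].
  exists m => //; have := label_ge2 st mst.
  by case: m mst => [|[|m]] // mst _; apply: (fiber_prod_lcm st mst).
by have := no_fiber_lcm st mst sz tz.
Qed.
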